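(* Strong positive definiteness and $c>0$ are preserved under taking subspaces. That is, let $X$ be a positive definite metric space and $Y\subseteq X$ a nonempty subspace. If $X$ is strongly positive definite, then so is $Y$; and if $c_{ij}(X)>0$ for all distinct $i,j\in X$, then $c_{ij}(Y)>0$ for all distinct $i,j\in Y$.
   Context: Metric spaces $(X,d)$ are finite and nonempty; subspaces carry the restricted metric. The similarity matrix $Z=Z(X)\in\mathbb{R}^{X\times X}$ has entries $z_{ij}=e^{-d(i,j)}$; $X$ is positive definite if $Z$ is. Then the weighting is $\mathbf{w}=Z^{-1}\mathbf{1}$ ($\mathbf{1}$ the all-ones vector). $K=K(X)=\tfrac12\big(I-\tfrac{\mathbf{1}\mathbf{1}^T}{n}\big)Z\big(I-\tfrac{\mathbf{1}\mathbf{1}^T}{n}\big)$ with $n=\#X$, $K^\dagger$ is its Moore--Penrose pseudoinverse, and $c_{ij}(X):=-(K(X)^\dagger)_{ij}$ for $i\neq j$. $X$ is strongly positive definite if it is positive definite, $c_{ij}(X)>0$ for all distinct $i,j\in X$ and $\mathbf{w}>0$ (entrywise). For a subspace $Y$, $c_{ij}(Y)$ and its weighting are constructed from $Y$ as a metric space. *)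

(* Defs.v *)
From HB Require Import structures.
From mathcomp Require Import all_boot all_order all_algebra.
From mathcomp Require Import all_classical all_reals all_analysis.

Set Implicit Arguments.
Unset Strict Implicit.
Unset Printing Implicit Defensive.
Import Order.TTheory GRing.Theory Num.Theory.
Local Open Scope ring_scope.

#[short(type="finMetricType")]
HB.structure Definition FinMetric (R : numDomainType) :=
  { M of Metric R M & Finite M }.

(* The subspace [Y] of [X] as a metric space in its own right.  It is an alias
   of the sigma type so that the restricted metric is attached to it alone. *)
Definition submetric (R : realType) (X : finMetricType R) (Y : {set X}) : Type :=
  {x : X | x \in Y}.

Section SubMetric.
Variables (R : realType) (X : finMetricType R) (Y : {set X}).

HB.instance Definition _ := Finite.on (submetric Y).

Let dist (u v : submetric Y) : R := mdist (sval u) (sval v).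

Let distxx u : dist u u = 0. Proof. exact: mdistxx. Qed.

Let dist_positivity u v : dist u v = 0 -> u = v.
Proof. by move=> /mdist_positivity; exact: val_inj. Qed.

Let dist_sym u v : dist u v = dist v u. Proof. exact: metric_sym. Qed.

Let dist_triangle v u w : dist u w <= dist u v + dist v w.
Proof. exact: metric_triangle. Qed.

HB.instance Definition _ := isMetric.Build R (submetric Y)
  distxx dist_positivity dist_sym dist_triangle.

Lemma mdist_submetric (u v : submetric Y) : mdist u v = mdist (sval u) (sval v).
Proof. by []. Qed.

End SubMetric.

Section MoorePenrose.
Variable R : realType.

Definition is_mp_inverse m n (A : 'M[R]_(m, n)) (B : 'M[R]_(n, m)) : Prop :=
  [/\ A *m B *m A = A, B *m A *m B = B,
      (A *m B)^T = A *m B & (B *m A)^T = B *m A].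

(* MathComp's [pinvmx] is only some generalised inverse; [mp_inverse] is the
   Moore-Penrose one, well defined by [mp_inverseP] and [mp_inverse_unique].
   The default value [0] is never used. *)
Definition mp_inverse m n (A : 'M[R]_(m, n)) : 'M[R]_(n, m) :=
  xget 0 [set B | is_mp_inverse A B]%classic.

Lemma gram_unitmx m n (B : 'M[R]_(m, n)) :
  row_free B -> B *m B^T \in unitmx.
Proof.
move=> fB; rewrite -row_free_unit -kermx_eq0.
apply/eqP/row_matrixP => i; rewrite row0; set u := row i _.
have uG : u *m (B *m B^T) = 0 by apply/sub_kermxP; exact: row_sub.
have /matrixP/(_ 0 0) : (u *m B) *m (u *m B)^T = 0.
  by rewrite trmx_mul mulmxA -(mulmxA u) uG mul0mx.
rewrite !mxE => /eqP; rewrite psumr_eq0; last first.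
  by move=> j _; rewrite [_^T _ _]mxE -expr2 sqr_ge0.
move=> /allP z; apply: (row_free_inj fB); rewrite mul0mx.
apply/rowP => j; have := z j (mem_index_enum _).
by rewrite [_^T _ _]mxE -expr2 sqrf_eq0 => /eqP ->; rewrite mxE.
Qed.

Lemma mp_inverse_exists m n (A : 'M[R]_(m, n)) : exists B, is_mp_inverse A B.
Proof.
have [r [C [D [AE fD fC]]]] : exists r (C : 'M[R]_(m, r)) (D : 'M[R]_(r, n)),
    [/\ A = C *m D, row_free D & row_free C^T].
  exists (\rank A), (col_base A), (row_base A).
  split; rewrite ?mulmx_base ?row_base_free //.
  by rewrite /row_free mxrank_tr; exact: col_base_full.
have uD : D *m D^T \in unitmx by exact: gram_unitmx.
have uC : C^T *m C \in unitmx by rewrite -{2}(trmxK C) gram_unitmx.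
set P := invmx (D *m D^T); set Q := invmx (C^T *m C).
have sP : P^T = P by rewrite /P trmx_inv trmx_mul trmxK.
have sQ : Q^T = Q by rewrite /Q trmx_inv trmx_mul trmxK.
pose B := D^T *m P *m (Q *m C^T).
have AB : A *m B = C *m Q *m C^T.
  by rewrite AE /B !mulmxA -(mulmxA C D) -(mulmxA C _ P) mulmxV // mulmx1.
have BA : B *m A = D^T *m P *m D.
  by rewrite AE /B !mulmxA -(mulmxA _ C^T C) -(mulmxA _ Q) mulVmx // mulmx1.
exists B; split.
- by rewrite AB {1}AE !mulmxA -(mulmxA _ C^T C) -(mulmxA _ Q) mulVmx // mulmx1 -AE.
- by rewrite BA /B !mulmxA -(mulmxA _ D D^T) -(mulmxA _ _ P) mulmxV // mulmx1.
- by rewrite AB !trmx_mul trmxK sQ mulmxA.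
- by rewrite BA !trmx_mul trmxK sP mulmxA.
Qed.

Lemma mp_inverse_unique m n (A : 'M[R]_(m, n)) B B' :
  is_mp_inverse A B -> is_mp_inverse A B' -> B = B'.
Proof.
move=> [a1 b1 s1 t1] [a2 b2 s2 t2].
have AB : A *m B = A *m B'.
  by rewrite -s1 -{1}a2 -mulmxA trmx_mul s1 s2 mulmxA a1.
have BA : B *m A = B' *m A.
  by rewrite -t1 -{1}a2 !mulmxA -(mulmxA (B *m A)) trmx_mul t1 t2 -mulmxA
    (mulmxA A) a1.
by rewrite -b1 BA -mulmxA AB mulmxA b2.
Qed.

Lemma mp_inverseP m n (A : 'M[R]_(m, n)) : is_mp_inverse A (mp_inverse A).
Proof.
have [B AB] := mp_inverse_exists A.
exact: (@xgetPex _ 0 [set B | is_mp_inverse A B]%classic (ex_intro _ B AB)).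
Qed.

End MoorePenrose.

Definition posdefmx (R : realType) n (A : 'M[R]_n) : Prop :=
  A^T = A /\ forall v : 'cV[R]_n, v != 0 -> 0 < (v^T *m A *m v) 0 0.

Lemma posdefmx_unit (R : realType) n (A : 'M[R]_n) :
  posdefmx A -> A \in unitmx.
Proof.
move=> [_ pA]; rewrite -row_free_unit -kermx_eq0.
apply/eqP/row_matrixP => i; rewrite row0; set u := row i _.
have uA : u *m A = 0 by apply/sub_kermxP; exact: row_sub.
apply/eqP/negPn/negP => u0; have := pA u^T.
by rewrite trmxK uA mul0mx mxE ltxx trmx_eq0 => /(_ u0).
Qed.

(* Matrices in R^(X x X) are indexed by ['I_#|X|] through [enum_val] and
   [enum_rank]. *)
Section Similarity.
Variables (R : realType) (X : finMetricType R).

Definition simmx : 'M[R]_#|X| :=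
  \matrix_(i, j) expR (- mdist (enum_val i) (enum_val j)).

Definition posdef_space : Prop := posdefmx simmx.

Definition ones : 'cV[R]_#|X| := const_mx 1.

Definition weighting (x : X) : R := (invmx simmx *m ones) (enum_rank x) 0.

Definition centering : 'M[R]_#|X| := 1%:M - #|X|%:R^-1 *: (ones *m ones^T).

Definition Kmx : 'M[R]_#|X| := 2^-1 *: (centering *m simmx *m centering).

Definition cmx (x y : X) : R := - mp_inverse Kmx (enum_rank x) (enum_rank y).

Definition c_pos : Prop := forall x y : X, x != y -> 0 < cmx x y.

Definition strongly_posdef : Prop :=
  [/\ posdef_space, c_pos & forall x : X, 0 < weighting x].

End Similarity.

Arguments posdef_space {R} X.
Arguments c_pos {R} X.
Arguments strongly_posdef {R} X.

(* Main.v *)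
Require Import Defs.
From HB Require Import structures.
From mathcomp Require Import all_boot all_order all_algebra.
From mathcomp Require Import all_classical all_reals all_analysis.

(** Write [Z] for the similarity matrix of a positive definite space, [w] for
    its weighting and [s > 0] for the sum of the entries of [w], the magnitude.
    The pseudoinverse of [K] is [2 L] with [L = Z^-1 - s^-1 w w^T]
    ([mp_inverse_Kmx]).  So [L] kills constants, and [c > 0] says that its
    off-diagonal entries are negative: [L] is the Laplacian of the complete
    graph with positive edge weights, and therefore obeys a minimum principle
    ([minimum_principle]).

    Passing from [X] to a subspace [Y] becomes a Dirichlet problem for the
    Laplacian of [X].  Fix [j] in [Y].  The [j]-th column of the Laplacian of
    [Y], extended by zero to [X], is [L h], where [h] equals the indicator of
    [j] on [Y] and is [L]-harmonic outside [Y].  By the minimum principle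
    [h >= 0], so for [i <> j] in [Y] the value [(L h) i], which is the sum of
    the [L i k * h k] over [k <> i], is at most [L i j < 0]
    ([mxlaplacian_mxsub_lt0]).

    In the same way the weighting of [Y], extended by zero, is [L g + t w] with
    [t > 0], where [g = 1] on [Y].  Outside [Y] this vanishes, so there
    [L g = - t w < 0], and the minimum principle for [- g] gives [g <= 1].  Hence
    [L g >= 0] on [Y], where [g] attains its maximum, and the weighting of [Y]
    is at least [t w > 0] there ([mxweight_mxsub_gt0]).

    Both arguments only see that the similarity matrix of [Y] is a principal
    submatrix of that of [X], so they are carried out for an arbitrary positive
    definite matrix and an injection [f] of index sets. *)

Local Open Scope ring_scope.

Set Implicit Arguments.
Unset Strict Implicit.
Unset Printing Implicit Defensive.
Import Order.TTheory GRing.Theory Num.Theory.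

(** * The Laplacian of a positive definite matrix *)

Definition onecv (R : pzRingType) n : 'cV[R]_n := const_mx 1.
Arguments onecv {R n}.

Definition mxweight (R : realType) n (A : 'M[R]_n) : 'cV[R]_n :=
  invmx A *m onecv.

Definition mxmagnitude (R : realType) n (A : 'M[R]_n) : R :=
  (onecv^T *m mxweight A) 0 0.

Definition mxlaplacian (R : realType) n (A : 'M[R]_n) : 'M[R]_n :=
  invmx A - (mxmagnitude A)^-1 *: (mxweight A *m (mxweight A)^T).

Section PositiveDefinite.
Variables (R : realType) (n : nat) (A : 'M[R]_n).
Hypotheses (n_gt0 : (0 < n)%N) (pA : posdefmx A).

Let uA : A \in unitmx. Proof. exact: posdefmx_unit. Qed.

(** The magnitude is the value at [w] of the quadratic form of [A]. *)
Lemma mxmagnitude_gt0 : 0 < mxmagnitude A.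
Proof.
have [sA pos] := pA.
have -> : mxmagnitude A = ((mxweight A)^T *m A *m mxweight A) 0 0.
  by rewrite /mxmagnitude {2}/mxweight trmx_mul trmx_inv sA mulmxKV.
apply: pos; apply/eqP => /(congr1 (mulmx A)).
rewrite mulKVmx // mulmx0 => /matrixP/(_ (Ordinal n_gt0) 0).
by rewrite !mxE => /eqP; rewrite oner_eq0.
Qed.

Let mag0 : mxmagnitude A != 0.
Proof. by rewrite gt_eqF// mxmagnitude_gt0. Qed.

Lemma trmx_mxlaplacian : (mxlaplacian A)^T = mxlaplacian A.
Proof.
by rewrite /mxlaplacian linearB linearZ /= trmx_mul trmxK trmx_inv (proj1 pA).
Qed.

Lemma mxlaplacian_onecv : mxlaplacian A *m (onecv : 'cV_n) = 0.
Proof.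
have w1 : (mxweight A)^T *m (onecv : 'cV_n) = (mxmagnitude A)%:M.
  apply: trmx_inj; rewrite trmx_mul trmxK tr_scalar_mx.
  exact: mx11_scalar.
rewrite mulmxBl -scalemxAl -mulmxA w1 mul_mx_scalar scalerA.
by rewrite mulVf // scale1r subrr.
Qed.

(** [A] and its Laplacian are inverse up to a rank-one error built on the
    constant vector, which disappears after centering. *)
Lemma mul_mx_mxlaplacian :
  A *m mxlaplacian A = 1%:M - (mxmagnitude A)^-1 *: (onecv *m (mxweight A)^T).
Proof. by rewrite mulmxBr mulmxV // -scalemxAr mulmxA mulKVmx. Qed.

Lemma mul_mxlaplacian_mx :
  mxlaplacian A *m A = 1%:M - (mxmagnitude A)^-1 *: (mxweight A *m onecv^T).
Proof.
apply: trmx_inj; rewrite trmx_mul trmx_mxlaplacian (proj1 pA).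
by rewrite mul_mx_mxlaplacian [RHS]linearB /= [(_ *: _)^T]linearZ /= trmx1
  [(_ *m onecv^T)^T]trmx_mul trmxK.
Qed.

End PositiveDefinite.

(** * The minimum principle *)

Section MinimumPrinciple.
Variables (R : realType) (n p : nat) (L : 'M[R]_n) (H : 'M[R]_(n, p)).
Hypothesis L1 : L *m onecv = 0 :> 'cV_n.

(** As [L] kills constants, the reference level [c] is free.  Taking the extreme
    value of the column [j] of [H] gives all the summands the same sign. *)
Lemma mulmx_onecv0E i j c : (L *m H) i j = \sum_k L i k * (H k j - c).
Proof.
have sumL : \sum_k L i k = 0.
  move/matrixP/(_ i 0): L1; rewrite !mxE => L1i; rewrite -[RHS]L1i.
  by apply: eq_bigr => k _; rewrite mxE mulr1.
under [RHS]eq_bigr => k _ do rewrite mulrBr.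
by rewrite sumrB -mulr_suml sumL mul0r subr0 mxE.
Qed.

Hypothesis L_lt0 : forall i k, i != k -> L i k < 0.

(** At a minimum [u] of [H _ j] every [L u k * (H k j - H u j)] is nonpositive.
    If the minimum were below [c], the term at [k = i0] would be negative, since
    no weight of the complete graph vanishes, and so would be [(L *m H) u j]. *)
Lemma minimum_principle i0 j c :
    c <= H i0 j -> (forall i, H i j < c -> 0 <= (L *m H) i j) ->
  forall i, c <= H i j.
Proof.
move=> ci0 sup i; rewrite leNgt; apply/negP => Hic.
case: (@arg_minP _ _ _ i predT (fun k => H k j) isT) => u _ umin.
have uc : H u j < c by apply: le_lt_trans Hic; exact: umin.
have ui0 : u != i0 by apply: contraTneq uc => ->; rewrite -leNgt.
have := sup u uc.
rewrite (mulmx_onecv0E _ _ (H u j)) leNgt => /negP; apply.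
rewrite (bigD1 i0) //= ltr_nwDl //.
  by rewrite nmulr_rlt0 ?L_lt0 // subr_gt0 (lt_le_trans uc).
apply: sumr_le0 => k _; have [->|uk] := eqVneq u k.
  by rewrite subrr mulr0.
by rewrite nmulr_rle0 ?L_lt0 // subr_ge0 umin.
Qed.

End MinimumPrinciple.

(** * Passing to a principal submatrix *)

Section PrincipalSubmatrix.
Variables (R : realType) (m n : nat) (A : 'M[R]_n) (f : 'I_m -> 'I_n).
Hypothesis f_inj : injective f.

Local Notation B := (mxsub f f A).

(** [E] is extension by zero along [f], and [E^T] is restriction along [f]. *)
Let E : 'M[R]_(n, m) := colsub f 1%:M.

Let tr_E : E^T = rowsub f 1%:M.
Proof. by apply/matrixP => i j; rewrite !mxE eq_sym. Qed.

Let tr_E_mulE p (H : 'M[R]_(n, p)) i j : (E^T *m H) i j = H (f i) j.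
Proof. by rewrite tr_E -rowsubE mxE. Qed.

Let tr_E_E : E^T *m E = 1%:M.
Proof. by apply/matrixP => i j; rewrite tr_E_mulE !mxE (inj_eq f_inj). Qed.

Let E_in p (H : 'M[R]_(m, p)) i j : (E *m H) (f i) j = H i j.
Proof. by rewrite -tr_E_mulE mulmxA tr_E_E mul1mx. Qed.

Let E_out p (H : 'M[R]_(m, p)) i j : i \notin codom f -> (E *m H) i j = 0.
Proof.
move=> fi; rewrite mxE big1 // => k _; rewrite !mxE.
by case: eqP fi => [->|]; rewrite ?codom_f ?mul0r.
Qed.

Let onecv_E : onecv^T *m E = onecv^T :> 'rV_m.
Proof.
apply: trmx_inj; rewrite trmx_mul !trmxK.
by apply/matrixP => i j; rewrite tr_E_mulE !mxE.
Qed.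

Let BE : E^T *m A *m E = B.
Proof.
by apply/matrixP => i j; rewrite -mulmxA tr_E_mulE mulmx_colsub mulmx1 !mxE.
Qed.

Lemma posdefmx_mxsub : posdefmx A -> posdefmx B.
Proof.
move=> [sA pA]; split; first by rewrite trmx_mxsub sA.
move=> v v0; rewrite -BE !mulmxA -trmx_mul -mulmxA; apply: pA.
by apply: contraNneq v0 => Ev; rewrite -[v]mul1mx -tr_E_E -mulmxA Ev mulmx0.
Qed.

Hypothesis pA : posdefmx A.
Let pB : posdefmx B. Proof. exact: posdefmx_mxsub. Qed.
Hypothesis L_lt0 : forall i k, i != k -> mxlaplacian A i k < 0.

(** The columns of [H] below are the harmonic extensions of the unit vectors
    from the image of [f]; multiplying them by the large Laplacian gives the
    small one, so that off-diagonal entries can only become more negative. *)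
Lemma mxlaplacian_mxsub_lt0 i j : i != j -> mxlaplacian B i j < 0.
Proof.
have m_gt0 : (0 < m)%N by apply: leq_ltn_trans (ltn_ord i).
have n_gt0 : (0 < n)%N by apply: leq_ltn_trans (ltn_ord (f i)).
move=> ij; have L1 := mxlaplacian_onecv n_gt0 pA.
(* Solving [L h = E l] for a column [l] of the small Laplacian gives [A E l]
   up to a constant, and the constant is fixed by the values on the image. *)
pose H : 'M[R]_(n, m) := A *m E *m mxlaplacian B
  + (mxmagnitude B)^-1 *: (onecv *m (mxweight B)^T).
have H_in k l : H (f k) l = (k == l)%:R.
  suff EH : E^T *m H = 1%:M by rewrite -tr_E_mulE EH mxE.
  have E1 : E^T *m onecv = onecv :> 'cV_m.
    by apply: trmx_inj; rewrite trmx_mul trmxK onecv_E.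
  rewrite mulmxDr !mulmxA BE mul_mx_mxlaplacian // -scalemxAr mulmxA E1.
  by rewrite subrK.
have LH : mxlaplacian A *m H = E *m mxlaplacian B.
  have oneL : onecv^T *m mxlaplacian B = 0 :> 'rV_m.
    apply: trmx_inj; rewrite trmx_mul trmxK trmx_mxlaplacian // trmx0.
    exact: mxlaplacian_onecv.
  rewrite mulmxDr -scalemxAr !mulmxA L1 mul0mx scaler0 addr0.
  rewrite mul_mxlaplacian_mx // !mulmxBl !mul1mx -!scalemxAl.
  by rewrite -(mulmxA _ _ E) onecv_E -(mulmxA _ _ (mxlaplacian B)) oneL mulmx0
    scaler0 subr0.
(* Outside the image of [f], [L H = E L_B] vanishes: [H] is harmonic there. *)
have H_ge0 k : 0 <= H k j.
  apply: (minimum_principle (i0 := f j) L1 L_lt0); first by rewrite H_in eqxx.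
  move=> u; rewrite LH; have [/codomP[l ->]|fu _] := boolP (u \in codom f).
    by rewrite H_in ltNge ler0n.
  by rewrite E_out.
rewrite -E_in -LH (mulmx_onecv0E _ L1 _ _ 0) (bigD1 (f j)) //= ltr_nwDl //.
  by rewrite H_in eqxx subr0 mulr1 L_lt0 // (inj_eq f_inj).
apply: sumr_le0 => k _; rewrite subr0; have [<-|ik] := eqVneq (f i) k.
  by rewrite H_in (negPf ij) mulr0.
by rewrite nmulr_rle0 ?L_lt0.
Qed.

Hypothesis w_gt0 : forall i, 0 < mxweight A i 0.

(** Here [g] equals [1] on the image of [f], and the minimum principle for [- g]
    shows that this is its maximum; [t] is the ratio of the two magnitudes. *)
Lemma mxweight_mxsub_gt0 i : 0 < mxweight B i 0.
Proof.
have m_gt0 : (0 < m)%N by apply: leq_ltn_trans (ltn_ord i).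
have n_gt0 : (0 < n)%N by apply: leq_ltn_trans (ltn_ord (f i)).
have L1 := mxlaplacian_onecv n_gt0 pA.
pose g := A *m E *m mxweight B.
pose t := (mxmagnitude A)^-1 * mxmagnitude B.
have t_gt0 : 0 < t by rewrite mulr_gt0 ?invr_gt0 ?mxmagnitude_gt0.
have g_in k : g (f k) 0 = 1.
  by rewrite -tr_E_mulE 2!mulmxA BE /mxweight mulKVmx ?mxE // posdefmx_unit.
have Lg : mxlaplacian A *m g = E *m mxweight B - t *: mxweight A.
  rewrite 2!mulmxA mul_mxlaplacian_mx // !mulmxBl !mul1mx -!scalemxAl.
  rewrite -(mulmxA _ _ E) onecv_E -(mulmxA _ _ (mxweight B)).
  by rewrite [onecv^T *m mxweight B]mx11_scalar mul_mx_scalar scalerA.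
have LgE k : (mxlaplacian A *m g) k 0
    = (E *m mxweight B) k 0 - t * mxweight A k 0.
  have ZE (M N : 'cV[R]_n) : (M - t *: N) k 0 = M k 0 - t * N k 0.
    by rewrite !mxE.
  by rewrite Lg ZE.
have g_le1 k : g k 0 <= 1.
  suff : -1 <= (- g) k 0 by rewrite mxE lerN2.
  apply: (minimum_principle (i0 := f i) L1 L_lt0); first by rewrite mxE g_in.
  move=> u; rewrite mulmxN; have [/codomP[l ->]|fu _] := boolP (u \in codom f).
    by rewrite mxE g_in ltxx.
  by rewrite mxE LgE E_out // sub0r opprK mulr_ge0 // ltW.
have -> : mxweight B i 0 = (mxlaplacian A *m g) (f i) 0 + t * mxweight A (f i) 0.
  by rewrite LgE E_in subrK.
apply: ltr_wpDl; last by rewrite mulr_gt0.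
rewrite (mulmx_onecv0E _ L1 _ _ 1) sumr_ge0 // => k _.
have [<-|ik] := eqVneq (f i) k; first by rewrite g_in subrr mulr0.
by rewrite nmulr_rge0 ?L_lt0 // subr_le0.
Qed.

End PrincipalSubmatrix.

(** * The pseudoinverse of the centered similarity matrix *)

Section Space.
Variables (R : realType) (X : finMetricType R).

(** Both products of [Kmx X] with [2 *: L] are the orthogonal projection
    [centering X], because [L] and [centering X] both kill constants. *)
Lemma mp_inverse_Kmx : (0 < #|X|)%N -> posdef_space X ->
  mp_inverse (Kmx X) = 2 *: mxlaplacian (simmx X).
Proof.
move=> X_gt0 pX; set Z := simmx X; set L := mxlaplacian Z.
set P := centering X.
have oneT_one : (ones X)^T *m ones X = #|X|%:R%:M.
  rewrite [LHS]mx11_scalar mxE; congr (_%:M).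
  under eq_bigr do rewrite !mxE mulr1.
  by rewrite sumr_const card_ord.
have P1 : P *m ones X = 0.
  rewrite mulmxBl mul1mx -scalemxAl -mulmxA oneT_one mul_mx_scalar scalerA.
  by rewrite mulVf ?scale1r ?subrr // pnatr_eq0 -lt0n.
have sP : P^T = P by rewrite linearB linearZ /= trmx1 trmx_mul trmxK.
have L1 : L *m ones X = 0 by exact: mxlaplacian_onecv.
have LT : L^T = L by exact: trmx_mxlaplacian.
have ZT : Z^T = Z by exact: (proj1 pX).
have PL : P *m L = L.
  apply: trmx_inj; rewrite trmx_mul sP LT mulmxBr mulmx1 -scalemxAr mulmxA.
  by rewrite L1 mul0mx scaler0 subr0.
have KL : Kmx X *m (2 *: L) = P.
  rewrite -scalemxAr -scalemxAl scalerA divff ?pnatr_eq0 // scale1r.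
  rewrite -!mulmxA PL mul_mx_mxlaplacian // mulmxBr mulmx1 -scalemxAr.
  by rewrite mulmxA P1 mul0mx scaler0 subr0.
have KT : (Kmx X)^T = Kmx X by rewrite linearZ /= !trmx_mul sP ZT mulmxA.
have LK : (2 *: L) *m Kmx X = P.
  by apply: trmx_inj; rewrite trmx_mul KT [(2 *: L)^T]linearZ /= LT KL sP.
have PP : P *m P = P.
  by rewrite {2}/P mulmxBr mulmx1 -scalemxAr mulmxA P1 mul0mx scaler0 subr0.
apply: mp_inverse_unique (mp_inverseP _) _; split.
- by rewrite KL -scalemxAr !mulmxA PP.
- by rewrite LK -scalemxAr PL.
- by rewrite KL.
- by rewrite LK.
Qed.

Lemma c_posP : posdef_space X ->
  c_pos X <-> forall i j, i != j -> mxlaplacian (simmx X) i j < 0.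
Proof.
move=> pX.
have cE (x y : X) :
    cmx x y = - (2 * mxlaplacian (simmx X) (enum_rank x) (enum_rank y)).
  rewrite /cmx mp_inverse_Kmx ?mxE //; apply/card_gt0P.
  by exists x.
split=> [cX i j ij|LX x y xy].
  have := cX (enum_val i) (enum_val j); rewrite (inj_eq enum_val_inj) => /(_ ij).
  by rewrite cE !enum_valK oppr_gt0 pmulr_rlt0.
by rewrite cE oppr_gt0 pmulr_rlt0 // LX // (inj_eq enum_rank_inj).
Qed.

End Space.

(** * Subspaces *)

Theorem proposition5p8 (R : realType) (X : finMetricType R) (Y : {set X}) :
  posdef_space X -> Y != finset.set0 ->
  (strongly_posdef X -> strongly_posdef (submetric Y)) /\
  (c_pos X -> c_pos (submetric Y)).
Proof.
move=> pX _.
pose f (i : 'I_#|(submetric Y : finMetricType R)|) : 'I_#|X| := enum_rank (sval (enum_val i)).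
have f_inj : injective f.
  by move=> i j /enum_rank_inj/val_inj/enum_val_inj.
have ZY : simmx (submetric Y) = mxsub f f (simmx X).
  by apply/matrixP => i j; rewrite !mxE /f !enum_rankK.
have pY : posdef_space (submetric Y).
  by rewrite /posdef_space ZY; exact: posdefmx_mxsub.
have cY : c_pos X -> c_pos (submetric Y).
  move=> /(c_posP pX) LX; apply/(c_posP pY) => i j ij.
  by rewrite ZY; exact: mxlaplacian_mxsub_lt0.
split=> // -[_ cX wX]; split=> // [|y]; first exact: cY.
rewrite /weighting ZY; apply: mxweight_mxsub_gt0 => //.
  exact/(c_posP pX).
by move=> i; have := wX (enum_val i); rewrite /weighting enum_valK.
Qed.
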